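(* Let $s\in(0,1)$ and let $\Omega\subset\mathbb{R}^n$ be a bounded open set with Lipschitz boundary. Let $\{E_k\}_{k\in\mathbb{N}}$ be a sequence of subsets of $\mathbb{R}^n$, each $s$-minimal in $\Omega$, with $E_k\xrightarrow{loc}E$ for some $E\subset\mathbb{R}^n$. Then $E$ is $s$-minimal in $\Omega$ and $$P_s(E,\Omega)=\lim_{k\to\infty}P_s(E_k,\Omega).$$
   Context: All sets are Lebesgue measurable and are identified up to sets of measure zero. For disjoint $A,B\subset\mathbb{R}^n$ put $\mathcal{L}_s(A,B)=\int_A\int_B\frac{dx\,dy}{|x-y|^{n+s}}\in[0,\infty]$. The $s$-perimeter of $E\subset\mathbb{R}^n$ in an open set $\Omega\subset\mathbb{R}^n$ is, writing $E^c=\mathbb{R}^n\setminus E$, $$P_s(E,\Omega)=\mathcal{L}_s(E\cap\Omega,E^c\cap\Omega)+\mathcal{L}_s(E\cap\Omega,E^c\setminus\Omega)+\mathcal{L}_s(E\setminus\Omega,E^c\cap\Omega).$$ $E$ is $s$-minimal in $\Omega$ if $P_s(E,\Omega)<\infty$ and $P_s(E,\Omega)\leq P_s(F,\Omega)$ for every $F\subset\mathbb{R}^n$ with $F\setminus\Omega=E\setminus\Omega$. $E_k\xrightarrow{loc}E$ means $\chi_{E_k}\to\chi_E$ in $L^1_{loc}(\mathbb{R}^n)$. *)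

(* Defs.v *)
From HB Require Import structures.
From mathcomp Require Import all_boot all_order all_algebra.
From mathcomp Require Import all_classical all_reals all_analysis.

Set Implicit Arguments.
Unset Strict Implicit.
Unset Printing Implicit Defensive.

Import Order.TTheory GRing.Theory Num.Theory.
Import numFieldNormedType.Exports.

Local Open Scope classical_set_scope.
Local Open Scope ring_scope.

(* The library norm on ['rV[R]_n] is the sup norm, so the Euclidean norm is
   defined here; both give the same open, bounded and compact sets. *)
Definition enorm (R : realType) (n : nat) (x : 'rV[R]_n) : R :=
  Num.sqrt (\sum_(i < n) x ord0 i ^+ 2).

Section Lebesgue.
Local Open Scope ereal_scope.
Context {R : realType} {n : nat}.
Implicit Types (a b : 'rV[R]_n) (X : set 'rV[R]_n).

Definition box a b : set 'rV[R]_n :=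
  [set x | forall i, x ord0 i \in `]a ord0 i, b ord0 i]].

Definition box_volume a b : R :=
  (\prod_(i < n) Num.max 0 (b ord0 i - a ord0 i))%R.

(* The boxes of a cover are indexed by an arbitrary [D : set nat]: for n = 0 no
   box is empty, so finite and empty covers have to be allowed explicitly. *)
Definition lebesgue_outer X : \bar R :=
  ereal_inf [set v | exists D (a b : nat -> 'rV[R]_n),
    X `<=` \bigcup_(k in D) box (a k) (b k) /\
    v = \esum_(k in D) (box_volume (a k) (b k))%:E].

Lemma box_volume_ge0 a b : 0 <= (box_volume a b)%:E.
Proof. by rewrite lee_fin; apply: prodr_ge0 => i _; rewrite le_max lexx. Qed.

Lemma lebesgue_outer_ge0 X : 0 <= lebesgue_outer X.
Proof.
apply: le_ereal_inf_tmp => _ [D [a [b [_ ->]]]].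
by apply: esum_ge0 => k _; exact: box_volume_ge0.
Qed.

Lemma lebesgue_outer0 : lebesgue_outer set0 = 0.
Proof.
apply/eqP; rewrite eq_le lebesgue_outer_ge0 andbT.
apply: ereal_inf_lbound; exists set0, (fun=> 0%R), (fun=> 0%R).
by split=> //; rewrite esum_set0.
Qed.

Lemma le_lebesgue_outer :
  {homo lebesgue_outer : A B / A `<=` B >-> A <= B}.
Proof.
move=> A B AB; apply: ereal_inf_le_tmp => _ [D [a [b [BD ->]]]].
by exists D, a, b; split=> //; exact: subset_trans AB BD.
Qed.

Lemma lebesgue_outer_sigma_subadditive : sigma_subadditive lebesgue_outer.
Proof.
move=> A; have [[i Aoo]|] := pselect (exists i, lebesgue_outer (A i) = +oo).
  rewrite (eseries_pinfty _ _ Aoo) ?leey// => k _.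
  by rewrite -ltNye (lt_le_trans _ (lebesgue_outer_ge0 _)).
rewrite -forallNE => Aoo; apply/lee_addgt0Pr => e e0.
apply: le_trans (epsilon_trick _ _ (ltW e0)); last first.
  by move=> k; exact: lebesgue_outer_ge0.
pose P k (C : set nat * (nat -> 'rV[R]_n) * (nat -> 'rV[R]_n)) :=
  A k `<=` \bigcup_(j in C.1.1) box (C.1.2 j) (C.2 j) /\
  \esum_(j in C.1.1) (box_volume (C.1.2 j) (C.2 j))%:E
    <= lebesgue_outer (A k) + (e / (2 ^ k.+1)%:R)%:E.
have [G PG] : {G & forall k, P k (G k)}.
  apply: (@choice _ _ P) => k.
  have fA : lebesgue_outer (A k) \is a fin_num.
    by rewrite ge0_fin_numE ?lebesgue_outer_ge0// ltey; exact/eqP/Aoo.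
  have ek : (0 < e / (2 ^ k.+1)%:R)%R by rewrite divr_gt0// ltr0n expn_gt0.
  have [_ [D [a [b [AD ->]]]] vlt] := lb_ereal_inf_adherent ek fA.
  by exists (D, a, b); split=> //=; exact: ltW.
pose D := [set p : nat * nat | (G p.1).1.1 p.2].
pose va (p : nat * nat) := (G p.1).1.2 p.2.
pose vb (p : nat * nat) := (G p.1).2 p.2.
have vol0 p : 0 <= (box_volume (va p) (vb p))%:E by exact: box_volume_ge0.
have /card_esym/ppcard_eqP[f] := card_nat2.
apply: (@le_trans _ _ (\esum_(p in D) (box_volume (va p) (vb p))%:E)).
  apply: ereal_inf_lbound; exists (f @^-1` D), (va \o f), (vb \o f); split.
    move=> x [k _ /(PG k).1[j Dj xj]]; exists (f^-1%FUN (k, j)).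
      by rewrite /= invK ?inE.
    by rewrite /= invK ?inE.
  rewrite (reindex_esum (f @^-1` D) D f)//; split.
  - by move=> x.
  - by move=> x y _ _; apply: (@inj _ _ [set: nat] f); rewrite inE.
  - by move=> p Dp; exists (f^-1%FUN p); rewrite /= invK ?inE.
have -> : D = \bigcup_(k in setT) (pair k @` (G k).1.1).
  rewrite eqEsubset; split=> [[k j] Dkj|_ [k _ [j Gj <-]]]//.
  by exists k => //; exists j.
rewrite esum_bigcupT//; last first.
  apply/trivIsetP => i j _ _ /eqP ij; rewrite predeqE => -[k l].
  by split=> //= -[[? _ [ik _]] [? _ [jk _]]]; apply: ij; rewrite ik jk.
rewrite nneseries_esumT; last first.
  move=> k; apply: adde_ge0; first exact: lebesgue_outer_ge0.
  by rewrite lee_fin divr_ge0// ltW.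
apply: le_esum => k _; rewrite (reindex_esum (G k).1.1 _ (pair k)).
  exact: (PG k).2.
by split=> [j ?|i j _ _ []//|_ [j ? <-]]; exists j.
Qed.

HB.instance Definition _ := isOuterMeasure.Build R 'rV[R]_n lebesgue_outer
  lebesgue_outer0 lebesgue_outer_ge0 le_lebesgue_outer
  lebesgue_outer_sigma_subadditive.

End Lebesgue.

(* [eucl R n] is ['rV[R]_n] with the sigma-algebra of Lebesgue measurable sets
   (in the sense of Caratheodory), on which [leb] is a complete measure. *)
Notation eucl R n := (caratheodory_type (@lebesgue_outer R n)).

Definition leb (R : realType) (n : nat) : set (eucl R n) -> \bar R :=
  lebesgue_outer.

HB.instance Definition _ (R : realType) (n : nat) :=
  isMeasure.Build _ (eucl R n) R (@leb R n)
    (@caratheodory_measure0 R 'rV[R]_n lebesgue_outer)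
    (@caratheodory_measure_ge0 R 'rV[R]_n lebesgue_outer)
    (@caratheodory_measure_sigma_additive R 'rV[R]_n lebesgue_outer).

Section Perimeter.
Local Open Scope ereal_scope.
Context {R : realType} {n : nat}.
Implicit Types (A B E F Omega : set (eucl R n)) (s : R).

Definition interaction s A B : \bar R :=
  \int[@leb R n]_(x in A) \int[@leb R n]_(y in B)
    ((enorm (x - y) `^ (n%:R + s))^-1)%:E.

Definition sperimeter s E Omega : \bar R :=
  interaction s (E `&` Omega) (~` E `&` Omega) +
  interaction s (E `&` Omega) (~` E `\` Omega) +
  interaction s (E `\` Omega) (~` E `&` Omega).

(* Sets are identified up to null sets, so the competitors are those that
   agree almost everywhere with [E] outside [Omega]. *)
Definition sminimal s E Omega : Prop :=
  sperimeter s E Omega < +oo /\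
  forall F, measurable F ->
    (@leb R n).-negligible ((F `\` Omega) `+` (E `\` Omega)) ->
    sperimeter s E Omega <= sperimeter s F Omega.

Definition cvg_L1loc (f_ : (eucl R n -> R)^nat) (f : eucl R n -> R) : Prop :=
  forall K : set 'rV[R]_n, compact K ->
    \int[@leb R n]_(x in K) `|f_ k x - f x|%:E @[k --> \oo] --> 0.

End Perimeter.

(* Near each boundary point, in suitable Cartesian coordinates [x *m Q],
   [Omega] is the strict epigraph, in direction [i], of a Lipschitz function of
   the other coordinates. *)
Definition lipschitz_boundary (R : realType) (n : nat) (Omega : set 'rV[R]_n) :=
  forall p, (closure Omega `\` interior Omega) p ->
  exists (r : R) (Q : 'M[R]_n) (i : 'I_n) (g : 'rV[R]_n.-1 -> R),
  [/\ 0 < r, Q *m Q^T = 1%:M,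
      exists L, forall u v, `|g u - g v| <= L * enorm (u - v)
    & forall x, enorm (x - p) < r ->
        (Omega x <-> g (col' i (x *m Q)) < (x *m Q) ord0 i)].

(* Main.v *)
From HB Require Import structures.
Require Import Defs.
From mathcomp Require Import all_boot all_order all_algebra.
From mathcomp Require Import all_classical all_reals all_analysis.
From mathcomp Require Import measurable_realfun ring lra.
Import Order.TTheory GRing.Theory Num.Theory.
Import numFieldNormedType.Exports.
Local Open Scope classical_set_scope.
Local Open Scope ring_scope.

(* Write the perimeter as the integral of [K (x, y) = |x - y| ^ - (n + s)] over
   the pairs with x in E, y outside E, and x or y in Omega.  By truncation of K,
   it is lower semicontinuous for local convergence in measure.  For a
   competitor F of E, the set equal to F in Omega and to [E_ k] outside is a
   competitor of [E_ k]; its perimeter exceeds that of F by at most the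
   interaction of Omega with the part of the complement of Omega where F and
   [E_ k] differ, which tends to 0 because the interaction of Omega with its
   complement is finite.  Hence limsup P(E_ k) <= P(F), and with lower
   semicontinuity P(E) <= P(F); the choice F = E gives the limit.

   The finiteness is where the Lipschitz boundary enters: near a boundary point
   the part of Omega at distance < d from the complement has measure O(d),
   because in a chart about 1/d disjoint translates of it fit in a fixed ball.
   Only points of that part see the complement in the dyadic shell of radius
   d, which contributes O(d ^ - s) each, and the sum of d ^ (1 - s) over
   dyadic d converges. *)

Set Implicit Arguments.
Unset Strict Implicit.

(** * Boxes, measurability and translations *)

Section Boxes.
Context {R : realType} {n : nat}.
Implicit Types (a b v : 'rV[R]_n) (X : set 'rV[R]_n) (i : 'I_n).

Definition row_upd a i c : 'rV[R]_n :=
  \row_j (if j == i then c else a ord0 j).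

Lemma row_updE a i c j :
  row_upd a i c ord0 j = if j == i then c else a ord0 j.
Proof. by rewrite mxE. Qed.

(** Cutting along a hyperplane changes only factor [i]; [min] and [max] make the identity cover
    empty boxes and hyperplanes that miss the box. *)
Lemma box_volume_split a b i (c : R) :
  box_volume a (row_upd b i (Num.min (b ord0 i) c)) +
  box_volume (row_upd a i (Num.max (a ord0 i) c)) b = box_volume a b.
Proof.
rewrite /box_volume (bigD1 i)//= [X in _ + X](bigD1 i)//= [RHS](bigD1 i)//=.
rewrite !row_updE eqxx.
set p := (\prod_(j < n | j != i) Num.max 0 (b ord0 j - a ord0 j)).
have -> : (\prod_(j < n | j != i)
    Num.max 0 (row_upd b i (Num.min (b ord0 i) c) ord0 j - a ord0 j)) = p.
  by apply: eq_bigr => j ji; rewrite row_updE (negbTE ji).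
have -> : (\prod_(j < n | j != i)
    Num.max 0 (b ord0 j - row_upd a i (Num.max (a ord0 i) c) ord0 j)) = p.
  by apply: eq_bigr => j ji; rewrite row_updE (negbTE ji).
rewrite -mulrDl; congr (_ * _).
move: (a ord0 i) (b ord0 i) => x y.
case: (lerP y c) => ?; case: (lerP x c) => ?; do ![case: (lerP 0 _) => ?]; lra.
Qed.

Lemma lebesgue_outer_cover X (D : set nat) (a b : nat -> 'rV[R]_n) :
  X `<=` \bigcup_(k in D) box (a k) (b k) ->
  (lebesgue_outer X <= \esum_(k in D) (box_volume (a k) (b k))%:E)%E.
Proof. by move=> XD; apply: ereal_inf_lbound; exists D, a, b. Qed.

(** Cutting each box of a cover of [X] along the hyperplane gives covers of the two parts of [X]
    with the same total volume; this is Caratheodory's condition. *)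
Lemma measurable_halfspace i (c : R) :
  measurable ([set x : 'rV[R]_n | x ord0 i <= c] : set (eucl R n)).
Proof.
apply: le_caratheodory_measurable => X.
apply: le_ereal_inf_tmp => _ [D [a [b [XD ->]]]].
under eq_esum => k _ do rewrite -(box_volume_split (a k) (b k) i c) EFinD.
rewrite esumD; [|by move=> *; exact: box_volume_ge0..].
apply: leeD; apply: lebesgue_outer_cover => x [/XD[k Dk kx] /= xc];
  exists k => //= j; have := kx j; rewrite row_updE; case: eqVneq => [->|//].
  by rewrite !in_itv/= le_min xc andbT.
by rewrite !in_itv/= gt_max (ltNge c); move/negP: xc => ->; rewrite andbT.
Qed.

Lemma leb_box a b : (leb (box a b : set (eucl R n)) <= (box_volume a b)%:E)%E.
Proof.
rewrite -(@esum_set1 _ _ 0%N (fun=> (box_volume a b)%:E)) ?box_volume_ge0//.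
by apply: lebesgue_outer_cover => x xab; exists 0%N.
Qed.

Lemma measurable_coord i :
  measurable_fun setT (fun x : eucl R n => (x : 'rV[R]_n) ord0 i).
Proof.
apply: (measurability _ (RGenOInfty.measurableE R)) => _ [_ [c ->] <-].
rewrite setTI.
have -> : (fun x : eucl R n => (x : 'rV[R]_n) ord0 i) @^-1` `]c, +oo[ =
          ~` [set x | x ord0 i <= c].
  by apply/seteqP; split => x /=; rewrite in_itv/= andbT ltNge => /negP.
exact/measurableC/measurable_halfspace.
Qed.

Lemma measurable_box a b : measurable (box a b : set (eucl R n)).
Proof.
have -> : box a b = \bigcap_(i in [set: 'I_n])
    ((fun x : eucl R n => (x : 'rV[R]_n) ord0 i) @^-1`
      [set` `]a ord0 i, b ord0 i]]).
  by apply/seteqP; split => [x xab i _|x xab i]; [exact: xab|exact: (xab i)].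
apply: fin_bigcap_measurable; first exact: finite_finset.
move=> i _; rewrite -[X in measurable X]setTI.
exact: measurable_coord.
Qed.

Lemma ball_rowE a e x : 0 < e ->
  ball a e x <-> forall i, `|a ord0 i - x ord0 i| < e.
Proof.
move=> e0; split=> [[_ ax] i|ax]; first exact: ax.
by split=> // j i; rewrite ord1; exact: ax.
Qed.

(** Every point of [U] lies in a box with rational corners contained in [U], and there are countably
    many of these. *)
Lemma open_measurable_eucl (U : set 'rV[R]_n) :
  open U -> measurable (U : set (eucl R n)).
Proof.
move=> oU.
pose F (p : 'rV[rat]_n * 'rV[rat]_n) : set (eucl R n) :=
  let B := box (map_mx ratr p.1) (map_mx ratr p.2) in
  if `[< B `<=` U >] then B else set0.
have -> : U = \bigcup_p F p.
  apply/seteqP; split=> [x Ux|x [p _]]; last first.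
    by rewrite /F; case: asboolP => // BU /BU.
  have /nbhs_ballP[e /= e0 xeU] : nbhs x U by exact: open_nbhs_nbhs.
  have /choice[p xp] : forall i, exists q : rat,
      ratr q \in `](x ord0 i - e), (x ord0 i)[.
    by move=> i; apply: rat_in_itvoo; rewrite ltrBlDr ltrDl.
  have /choice[q xq] : forall i, exists q : rat,
      ratr q \in `](x ord0 i), (x ord0 i + e)[.
    by move=> i; apply: rat_in_itvoo; rewrite ltrDl.
  exists (\row_i p i, \row_i q i) => //; rewrite /F/=; case: asboolP => [_ i|].
    move: (xp i) (xq i); rewrite !mxE !in_itv/=.
    by move=> /andP[_ ->] /andP[/ltW ->].
  case=> y xy; apply: xeU; apply/ball_rowE => // i.
  move: (xp i) (xq i) (xy i); rewrite !mxE !in_itv/= ltr_distl.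
  move=> /andP[pi _] /andP[_ qi] /andP[py yq].
  by apply/andP; split; move: pi qi py yq; move: (ratr _) (ratr _) => P Q; lra.
apply: countable_bigcupT_measurable => [|p].
  exact: countableP.
by rewrite /F; case: asboolP => // _; exact: measurable_box.
Qed.

Lemma closed_measurable_eucl (U : set 'rV[R]_n) :
  closed U -> measurable (U : set (eucl R n)).
Proof.
move=> cU; rewrite -[U]setCK; apply: measurableC.
by apply: open_measurable_eucl; exact: closed_openC.
Qed.

Lemma leb_ball a e : 0 < e ->
  (leb (ball a e : set (eucl R n)) <= ((e *+ 2) ^+ n)%:E)%E.
Proof.
move=> e0; apply: (@le_trans _ _ (leb (box (a - const_mx e) (a + const_mx e)
    : set (eucl R n)))).
  apply: le_measure; rewrite ?inE.
  - by apply: open_measurable_eucl; exact: ball_open.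
  - exact: measurable_box.
  - move=> x /ball_rowE ax i; have := ax e0 i.
    rewrite !mxE in_itv/= ltr_distl => /andP[? ?]; apply/andP; split; lra.
apply: le_trans (leb_box _ _) _; rewrite lee_fin /box_volume.
under eq_bigr => i _ do rewrite !mxE.
under eq_bigr => i _.
  rewrite (_ : _ - _ = e *+ 2); last by rewrite mulr2n; lra.
  rewrite max_r ?mulrn_wge0 ?ltW//.
  over.
by rewrite prodr_const card_ord.
Qed.

Lemma leb_sigma_finite : sigma_finite setT (@leb R n).
Proof.
exists (fun k => ball (0 : 'rV[R]_n) k.+1%:R).
  apply/seteqP; split=> // x _.
  exists (Num.truncn `|x|) => //=.
  rewrite mx_norm_ball /ball_/= sub0r normrN.
  exact: truncnS_gt.
move=> k; split; first by apply: open_measurable_eucl; exact: ball_open.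
exact: le_lt_trans (leb_ball _ _) (ltry _).
Qed.

Lemma box_volumeD a b v : box_volume (a + v) (b + v) = box_volume a b.
Proof.
apply: eq_bigr => i _; rewrite !mxE; congr (Num.max _ _).
by rewrite opprD addrACA subrr addr0.
Qed.

Definition translate v X : set 'rV[R]_n := [set x | X (x - v)].

Lemma translateK v X : translate (- v) (translate v X) = X.
Proof. by apply/seteqP; split => x; rewrite /translate/= opprK addrK. Qed.

(** One inequality for all translations suffices, the inverse translation giving the other; it comes
    from translating the boxes of a cover. *)
Lemma lebesgue_outer_translate v X :
  lebesgue_outer (translate v X) = lebesgue_outer X.
Proof.
suff H u Y : (lebesgue_outer (translate u Y) <= lebesgue_outer Y)%E.
  apply/eqP; rewrite eq_le H/=.
  by rewrite -{1}(translateK v X) H.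
apply: le_ereal_inf_tmp => _ [D [a [b [YD ->]]]].
under eq_esum => k _ do rewrite -(box_volumeD _ _ u).
apply: (lebesgue_outer_cover (a := fun k => a k + u) (b := fun k => b k + u)).
move=> x /YD[k Dk xk]; exists k => // i.
by move: (xk i); rewrite !mxE !in_itv/= ltrBrDr lerBlDr.
Qed.

Lemma measurable_translate v (A : set (eucl R n)) :
  measurable A -> measurable (translate v A : set (eucl R n)).
Proof.
move=> mA; suff : (@lebesgue_outer R n).-caratheodory (translate v A) by [].
have {}mA : (@lebesgue_outer R n).-caratheodory A by [].
move=> X; have := mA (translate (- v) X).
rewrite -[X in lebesgue_outer (_ `&` X)](translateK v A).
rewrite -[X in lebesgue_outer (_ `&` ~` X)](translateK v A).
rewrite [X in _ = X + _](_ : _ =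
  lebesgue_outer (translate (- v) (X `&` translate v A)))//.
rewrite [X in _ = _ + X](_ : _ =
  lebesgue_outer (translate (- v) (X `&` ~` translate v A)))//.
by rewrite !lebesgue_outer_translate.
Qed.

End Boxes.

HB.instance Definition _ (R : realType) (n : nat) :=
  Measure_isSigmaFinite.Build _ _ _ (@leb R n) (@leb_sigma_finite R n).

(** * Lower semicontinuity of integrals over varying sets *)

Lemma cvge0_lt (R : realType) (u : (\bar R)^nat) (e : \bar R) :
  u k @[k --> \oo] --> 0%E -> (0 < e)%E -> \forall k \near \oo, (u k < e)%E.
Proof.
by move=> u0 e0; exact: (u0 _ (@open_ereal_lt' _ 0%E e e0)).
Qed.

Section LowerSemicontinuity.
Local Open Scope ereal_scope.
Context d (T : measurableType d) (R : realType) (mu : {measure set T -> \bar R}).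
Variables (f : T -> R) (X : (set T)^nat).
Hypotheses (mf : measurable_fun setT f) (f0 : forall x, (0 <= f x)%R).
Hypothesis mX : forall M, measurable (X M).
Hypotheses (ndX : {homo X : M N / (M <= N)%N >-> M `<=` N})
  (XT : forall x, exists M, X M x).
Implicit Types (A : set T).

(** It increases to [f] with [M]. Being at most [M] and zero outside [X M], it loses at most [M]
    times the measure of what is removed from the domain inside [X M]. *)
Let trunc M x : R := (Num.min (f x) M%:R * \1_(X M) x)%R.

Let trunc_ge0 M x : (0 <= trunc M x)%R.
Proof. by rewrite mulr_ge0// le_min f0/=. Qed.

Let trunc_le M x : (trunc M x <= f x)%R.
Proof.
apply: (@le_trans _ _ (Num.min (f x) M%:R)); last by rewrite ge_min lexx.
by rewrite ler_piMr ?le_min ?f0//= indicE lern1 leq_b1.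
Qed.

Let mtrunc M : measurable_fun setT (trunc M).
Proof.
apply: measurable_funM; last exact: measurable_indic.
exact: measurable_minr.
Qed.

Let emeas (g : T -> R) A : measurable_fun setT g ->
  measurable_fun A (fun x => (g x)%:E).
Proof. by move=> mg; apply/measurable_EFinP; exact: measurable_funTS. Qed.

Let int_trunc A : measurable A ->
  \int[mu]_(x in A) (trunc M x)%:E @[M --> \oo] --> \int[mu]_(x in A) (f x)%:E.
Proof.
move=> mA.
have -> : \int[mu]_(x in A) (f x)%:E =
    \int[mu]_(x in A) limn (fun M => (trunc M x)%:E).
  apply: eq_integral => x _; apply/esym/lim_near_cst => //.
  have [N XN] := XT x; near=> M.
  have XM : X M x by apply: ndX XN; near: M; exact: nbhs_infty_ge.
  rewrite /trunc indicE mem_set// mulr1 min_l//.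
  near: M; exact: nbhs_infty_ger.
apply: cvg_monotone_convergence => //.
- by move=> M; exact: emeas.
- by move=> M x _; rewrite lee_fin.
- move=> x _ M N MN; rewrite lee_fin ler_pM// ?le_min ?f0//=.
    by rewrite ge_min lexx/= ge_min ler_nat MN orbT.
  rewrite !indicE ler_nat; case: (boolP (x \in X M)) => //.
  by rewrite inE => /(ndX MN) ?; rewrite mem_set.
Unshelve. all: by end_near. Qed.

(** Some truncation already has integral above [c] over [A]. Replacing [A] by [A_ k] loses at most
    [M] times the measure, inside [X M], of the part of [A] outside [A_ k], and this tends to 0. *)
Lemma integral_lsc A (A_ : (set T)^nat) : measurable A -> (forall k, measurable (A_ k)) ->
  (forall M, mu ((A `\` A_ k) `&` X M) @[k --> \oo] --> 0) ->
  forall c, c < \int[mu]_(x in A) (f x)%:E ->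
  \forall k \near \oo, c < \int[mu]_(x in A_ k) (f x)%:E.
Proof.
move=> mA mA_ A0 c cA.
have [M cM] : exists M, c < \int[mu]_(x in A) (trunc M x)%:E.
  apply: contrapT => /forallNP H; move: cA; apply/negP; rewrite -leNgt.
  rewrite -(cvg_lim _ (int_trunc mA))//; apply: lime_le.
    by apply/cvg_ex; eexists; exact: int_trunc.
  by near=> M; rewrite leNgt; apply/negP/H.
have trA k : \int[mu]_(x in A) (trunc M x)%:E <=
    \int[mu]_(x in A_ k) (f x)%:E + M%:R%:E * mu ((A `\` A_ k) `&` X M).
  have mD : measurable (A `\` A_ k) by exact: measurableD.
  apply: (@le_trans _ _ (\int[mu]_(x in A_ k `|` (A `\` A_ k)) (trunc M x)%:E)).
    apply: ge0_subset_integral => //.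
    - exact: measurableU.
    - exact: emeas.
    - by move=> x _; rewrite lee_fin.
    - by move=> x Ax; have [|] := pselect (A_ k x); [left|right].
  rewrite ge0_integral_setU//; last 3 first.
  - exact: emeas.
  - by move=> x _; rewrite lee_fin.
  - by apply/disj_setPS => x [? []].
  apply: leeD.
    apply: ge0_le_integral => //; [|exact: emeas|exact: emeas|].
    - by move=> x _; rewrite lee_fin.
    - by move=> x _; rewrite lee_fin.
  apply: (@le_trans _ _ (\int[mu]_(x in A `\` A_ k) (M%:R * \1_(X M) x)%:E)).
    apply: ge0_le_integral => //; [|exact: emeas| |].
    - by move=> x _; rewrite lee_fin.
    - by apply: emeas; apply: measurable_funM => //; exact: measurable_indic.
    - by move=> x _; rewrite lee_fin ler_wpM2r// ge_min lexx orbT.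
  under eq_integral do rewrite EFinM.
  rewrite ge0_integralZl//.
  - by rewrite integral_indic// setIC.
  - by apply: emeas; exact: measurable_indic.
have J0 k : 0 <= \int[mu]_(x in A_ k) (f x)%:E.
  by apply: integral_ge0 => x _; rewrite lee_fin.
have [c0|c0] := ltP c 0; first by near=> k; exact: lt_le_trans c0 (J0 k).
case: c c0 cA cM => [c| |//] c0 _ cM; last by rewrite ltNge leey in cM.
have [e e0 ce] : exists2 e : R, (0 < e)%R &
    (c + e)%:E < \int[mu]_(x in A) (trunc M x)%:E.
  move: cM; case: (\int[mu]_(x in A) _) => [r| |]//; last first.
    by move=> _; exists 1%R => //; rewrite ltry.
  rewrite lte_fin => cr; exists ((r - c) / 2)%R; first by rewrite divr_gt0// subr_gt0.
  by rewrite lte_fin; lra.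
(* The denominator [M.+1] covers the case [M = 0]. *)
have e'0 : 0 < (e / (M.+1)%:R)%:E by rewrite lte_fin divr_gt0.
have := cvge0_lt (A0 M) e'0; apply: filterS => k /ltW mue.
have {}mue : M%:R%:E * mu ((A `\` A_ k) `&` X M) <= e%:E.
  apply: (@le_trans _ _ (M.+1%:R%:E * (e / (M.+1)%:R)%:E)).
    by rewrite lee_pmul ?lee_fin ?ler_nat.
  by rewrite -EFinM mulrCA divff ?mulr1.
have := lt_le_trans ce (le_trans (trA k) (leeD2l _ mue)).
by rewrite EFinD lteD2rE.
Unshelve. all: by end_near. Qed.

(** Lower semicontinuity is applied to the complements of [A_ k] in [A]: their integrals eventually
    exceed the finite total minus [e], which leaves less than [e] for [A_ k]. *)
Lemma integral_cvg0 A (A_ : (set T)^nat) : measurable A ->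
  (forall k, measurable (A_ k)) -> (forall k, A_ k `<=` A) ->
  \int[mu]_(x in A) (f x)%:E < +oo ->
  (forall M, mu (A_ k `&` X M) @[k --> \oo] --> 0) ->
  forall e, (0 < e)%R ->
  \forall k \near \oo, \int[mu]_(x in A_ k) (f x)%:E < e%:E.
Proof.
move=> mA mA_ A_A fA A0 e e0.
have f0' D : 0 <= \int[mu]_(x in D) (f x)%:E.
  by apply: integral_ge0 => x _; rewrite lee_fin.
have fE k : \int[mu]_(x in A) (f x)%:E =
    \int[mu]_(x in A_ k) (f x)%:E + \int[mu]_(x in A `\` A_ k) (f x)%:E.
  rewrite -ge0_integral_setU//; first by rewrite setDUK.
  - exact: measurableD.
  - exact: emeas.
  - by move=> x _; rewrite lee_fin.
  - by apply/disj_setPS => x [? []].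
have ffin : \int[mu]_(x in A) (f x)%:E \is a fin_num by rewrite ge0_fin_numE.
have : \int[mu]_(x in A) (f x)%:E - e%:E < \int[mu]_(x in A) (f x)%:E.
  by rewrite lteBlDr// lteDl// lte_fin.
move=> /(integral_lsc (A_ := fun k => A `\` A_ k) mA) H.
have {}H := H (fun k => measurableD mA (mA_ k)).
apply: filterS (H _) => [k|M].
  have := ffin; rewrite (fE k) fin_numD => /andP[_ fin'].
  by rewrite lteBlDr// addeC lteD2lE.
under eq_fun do rewrite setDD (setIidr (A_A _)).
exact: A0.
Qed.

End LowerSemicontinuity.

(** * Euclidean norm and kernel *)

Section Enorm.
Context {R : realType} {n : nat}.
Implicit Types (x y : 'rV[R]_n).

Lemma enorm_ge0 x : 0 <= enorm x.
Proof. exact: sqrtr_ge0. Qed.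

Lemma enormN x : enorm (- x) = enorm x.
Proof. by congr Num.sqrt; apply: eq_bigr => i _; rewrite !mxE sqrrN. Qed.

Lemma enormB x y : enorm (x - y) = enorm (y - x).
Proof. by rewrite -enormN opprB. Qed.

Lemma ler_coord_enorm x (i : 'I_n) : `|x ord0 i| <= enorm x.
Proof.
rewrite -sqrtr_sqr ler_sqrt; last by apply: sumr_ge0 => j _; exact: sqr_ge0.
by rewrite (bigD1 i)//= lerDl; apply: sumr_ge0 => j _; exact: sqr_ge0.
Qed.

Lemma enorm_le x (c : R) : 0 <= c -> (forall i, `|x ord0 i| <= c) ->
  enorm x <= n%:R * c.
Proof.
move=> c0 xc; rewrite -[leRHS]ger0_norm ?mulr_ge0// -[leRHS]sqrtr_sqr ler_sqrt ?sqr_ge0//.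
apply: (@le_trans _ _ (\sum_(i < n) c ^+ 2)).
  apply: ler_sum => i _; rewrite -[_ ^+ 2]ger0_norm ?sqr_ge0// normrX.
  by rewrite lerXn2r ?nnegrE.
rewrite sumr_const card_ord -[leLHS]mulr_natl exprMn ler_wpM2r ?sqr_ge0//.
by rewrite expr2 -natrM ler_nat; case: (n) => // m; rewrite leq_pmulr.
Qed.

Lemma enorm_eq0 x : enorm x = 0 -> x = 0.
Proof.
move=> x0; apply/rowP => i; rewrite mxE; apply/eqP; rewrite -normr_le0 -x0.
exact: ler_coord_enorm.
Qed.

End Enorm.

Lemma enorm_orthogonal (R : realType) (n : nat) (Q : 'M[R]_n) (x : 'rV[R]_n) :
  Q *m Q^T = 1%:M -> enorm (x *m Q) = enorm x.
Proof.
have E (y : 'rV[R]_n) : \sum_(i < n) y ord0 i ^+ 2 = (y *m y^T) ord0 ord0 :> R.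
  by rewrite mxE; apply: eq_bigr => i _; rewrite mxE.
by move=> QQ; rewrite /enorm !E trmx_mul mulmxA -(mulmxA x) QQ mulmx1.
Qed.

Lemma enorm_col' (R : realType) (n : nat) (i : 'I_n) (x : 'rV[R]_n) :
  enorm (col' i x) <= enorm x.
Proof.
case: n => [[]//|n] in i x *.
rewrite ler_sqrt; last by apply: sumr_ge0 => j _; exact: sqr_ge0.
rewrite (bigD1_ord i)//= [leLHS](eq_bigr (fun j => x ord0 (lift i j) ^+ 2)).
  by rewrite lerDr sqr_ge0.
by move=> j _; rewrite !mxE.
Qed.

(** * The kernel, and the perimeter as one integral over pairs *)

Section Kernel.
Context {R : realType} {n : nat}.
Variable s : R.
Implicit Types (A B E Omega : set (eucl R n)).
Local Notation mu := (@leb R n).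
Local Notation mu2 := (mu \x mu)%E.

Definition kern (z : eucl R n * eucl R n) : R :=
  (enorm ((z.1 : 'rV[R]_n) - z.2) `^ (n%:R + s))^-1.

Lemma kern_ge0 z : 0 <= kern z.
Proof. by rewrite invr_ge0 powR_ge0. Qed.

Lemma kern_sym x y : kern (x, y) = kern (y, x).
Proof. by rewrite /kern/= enormB. Qed.

Lemma measurable_enormB :
  measurable_fun setT (fun z : eucl R n * eucl R n =>
    enorm ((z.1 : 'rV[R]_n) - z.2)).
Proof.
apply: (@measurableT_comp _ _ _ _ _ _ (@Num.sqrt R)).
  by apply: continuous_measurable_fun; exact: sqrt_continuous.
apply: measurable_sum => i; apply: measurable_funX.
under eq_fun do rewrite !mxE.
apply: measurable_funB.
  exact: (measurableT_comp (measurable_coord i) measurable_fst).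
exact: (measurableT_comp (measurable_coord i) measurable_snd).
Qed.

Lemma measurable_kern : measurable_fun setT kern.
Proof.
rewrite /kern; under eq_fun do rewrite -powRN.
apply: (@measurableT_comp _ _ _ _ _ _ (fun x : R => x `^ (- (n%:R + s)))).
  exact: measurable_powR.
exact: measurable_enormB.
Qed.

(** Tonelli's theorem for the kernel extended by 0 outside the product of [A] and [B]. *)
Lemma interactionE A B : measurable A -> measurable B ->
  interaction s A B = (\int[mu2]_(z in A `*` B) (kern z)%:E)%E.
Proof.
move=> mA mB.
rewrite [RHS]integral_mkcond fubini_tonelli1; last 2 first.
- apply/(measurable_restrictT _ (measurableX mA mB)).
  by apply/measurable_EFinP/measurable_funTS; exact: measurable_kern.
- by move=> z; apply: erestrict_ge0 => ? _; rewrite lee_fin kern_ge0.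
rewrite /interaction integral_mkcond; apply: eq_integral => x _.
rewrite /fubini_F [LHS]/patch; case: ifPn => xA.
  rewrite [LHS]integral_mkcond; apply: eq_integral => y _.
  rewrite /patch; congr (if _ then _ else _).
  by rewrite in_setX/= xA.
rewrite [RHS]integral0_eq// => y _.
by rewrite /patch in_setX/= (negbTE xA).
Qed.

(** Tonelli's theorem in both orders, and the symmetry of the kernel. *)
Lemma interactionC A B : measurable A -> measurable B ->
  interaction s A B = interaction s B A.
Proof.
move=> mA mB; rewrite !interactionE// [LHS]integral_mkcond [RHS]integral_mkcond.
have mK C D : measurable C -> measurable D ->
    measurable_fun setT ((fun z => (kern z)%:E) \_ (C `*` D)).
  move=> mC mD; apply/(measurable_restrictT _ (measurableX mC mD)).
  by apply/measurable_EFinP/measurable_funTS; exact: measurable_kern.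
have K0 C D z : (0 <= ((fun z => (kern z)%:E) \_ (C `*` D)) z)%E.
  by apply: erestrict_ge0 => ? _; rewrite lee_fin kern_ge0.
rewrite [LHS]fubini_tonelli1; [|exact: mK|exact: K0].
rewrite [RHS]fubini_tonelli2; [|exact: mK|exact: K0].
apply: eq_integral => x _; apply: eq_integral => y _.
by rewrite /patch !in_setX/= andbC kern_sym.
Qed.

Definition crossing E Omega : set (eucl R n * eucl R n) :=
  [set z | [/\ E z.1, ~ E z.2 & Omega z.1 \/ Omega z.2]].

Lemma crossingE E Omega : crossing E Omega =
  ((E `&` Omega) `*` (~` E `&` Omega)) `|`
  ((E `&` Omega) `*` (~` E `\` Omega)) `|`
  ((E `\` Omega) `*` (~` E `&` Omega)).
Proof.
apply/seteqP; split=> [[x y] [/= Ex Ey]|[x y] [[]|]/= [[? ?] [? ?]]].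
- by have [] := pselect (Omega x); have [] := pselect (Omega y); tauto.
- by split=> //=; left.
- by split=> //=; left.
- by split=> //=; right.
Qed.

Lemma measurable_crossing E Omega : measurable E -> measurable Omega ->
  measurable (crossing E Omega).
Proof.
move=> mE mO; rewrite crossingE; have mEC := measurableC mE.
by apply: measurableU; [apply: measurableU|]; apply: measurableX;
  (exact: measurableI || exact: measurableD).
Qed.

(** The three interactions are integrals over pairwise disjoint products that fill
    [crossing E Omega]. *)
Lemma sperimeterE E Omega : measurable E -> measurable Omega ->
  sperimeter s E Omega = (\int[mu2]_(z in crossing E Omega) (kern z)%:E)%E.
Proof.
move=> mE mO; have mEC := measurableC mE.
have mK D : measurable_fun D (EFin \o kern).
  by apply/measurable_EFinP/measurable_funTS; exact: measurable_kern.
have mEO := measurableI _ _ mE mO; have mECO := measurableI _ _ mEC mO.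
have mED := measurableD mE mO; have mECD := measurableD mEC mO.
rewrite /sperimeter !interactionE// crossingE.
have mX1 := measurableX mEO mECO; have mX2 := measurableX mEO mECD.
have mX3 := measurableX mED mECO.
have k0 z : (0 <= (kern z)%:E)%E by rewrite lee_fin kern_ge0.
rewrite ge0_integral_setU//; [|exact: measurableU|]; last first.
  by apply/disj_setPS => -[x y] [] [|] /= [[? ?] [? ?]] [[? ?] [? ?]].
rewrite ge0_integral_setU//.
by apply/disj_setPS => -[x y] [] /= [[? ?] [? ?]] [[? ?] [? ?]].
Qed.

End Kernel.

(** * Finite interaction with the complement *)

Lemma nneseries_geometric_lty (R : realType) (a q : R) :
  0 <= a -> 0 < q < 1 -> (\sum_(0 <= k <oo) (a * q ^+ k)%:E < +oo)%E.
Proof.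
move=> a0 /andP[q0 q1]; apply: (@le_lt_trans _ _ (a * (1 - q)^-1)%:E).
  apply: lime_le.
    apply: is_cvg_nneseries => k _ _.
    by rewrite lee_fin mulr_ge0// exprn_ge0// ltW.
  apply: nearW => N; rewrite sumEFin lee_fin.
  by apply: (geometric_le_lim N a0 q0); rewrite ger0_norm// ltW.
exact: ltry.
Qed.

Lemma powR_exprn (R : realType) (x r : R) (k : nat) : 0 <= x ->
  (x ^+ k) `^ r = (x `^ r) ^+ k.
Proof. by move=> x0; rewrite -powR_mulrn// -powRrM mulrC powRrM powR_mulrn ?powR_ge0. Qed.

Lemma powR2N_lt1 (R : realType) (t : R) : 0 < t -> 0 < (2 : R) `^ (- t) < 1.
Proof.
move=> t0; rewrite powR_gt0//= powRN invf_lt1 ?powR_gt0//.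
have := @gt0_ltr_powR R t t0 1 2; rewrite powR1; apply; rewrite ?nnegrE//.
by rewrite ltr1n.
Qed.

Lemma exists_pow2_gt (R : realType) (c : R) : exists k : nat, c < 2 ^+ k.
Proof.
exists (Num.truncn c).+1; apply: lt_le_trans (truncnS_gt c) _.
by rewrite -natrX ler_nat ltnW// ltn_expl.
Qed.

(** The least [k] with the lower bound works: minimality gives the upper bound, or [t < a] does when
    [k = 0]. *)
Lemma dyadic_shell_near (R : realType) (t a : R) : 0 < t -> t < a ->
  exists k : nat, a / 2 ^+ k / 2 <= t < a / 2 ^+ k.
Proof.
move=> t0 ta; have a0 : 0 < a by exact: lt_trans ta.
have [k0 k0P] := exists_pow2_gt (a / t).
have ex : exists k : nat, a / 2 ^+ k.+1 <= t.
  exists k0; rewrite ler_pdivrMr ?exprn_gt0// exprS.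
  move: k0P; rewrite ltr_pdivrMr// => /ltW k0P.
  by rewrite (le_trans k0P)// mulrC ler_pM2l// ler_peMl ?exprn_ge0// ler1n.
case: (ex_minnP ex) => k kt kmin; exists k.
rewrite -mulrA -invfM -exprSr kt/=.
case: k kt kmin => [|k] kt kmin; first by rewrite expr0 divr1.
by rewrite ltNge; apply/negP => /kmin; rewrite ltnn.
Qed.

(** The least [k] with the upper bound works: minimality gives the lower bound, or [a <= t] does
    when [k = 0]. *)
Lemma dyadic_shell_far (R : realType) (t a : R) : 0 < a -> a <= t ->
  exists k : nat, a * 2 ^+ k.+1 / 2 <= t < a * 2 ^+ k.+1.
Proof.
move=> a0 at'; have t0 : 0 < t by exact: lt_le_trans at'.
have ex : exists k : nat, t < a * 2 ^+ k.+1.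
  have [k0 k0P] := exists_pow2_gt (t / a); exists k0.
  move: k0P; rewrite ltr_pdivrMr// mulrC => /lt_le_trans; apply.
  by rewrite ler_pM2l// exprS ler_peMl ?exprn_ge0// ler1n.
case: (ex_minnP ex) => k kt kmin; exists k; rewrite kt andbT.
rewrite exprSr mulrA mulfK//.
case: k kt kmin => [|k] kt kmin; first by rewrite expr0 mulr1.
by rewrite leNgt; apply/negP => /kmin; rewrite ltnn.
Qed.

Lemma ge0_integral_le_bigcup d (T : measurableType d) (R : realType)
    (mu : {measure set T -> \bar R}) (f : T -> \bar R) (A : set T)
    (A_ : (set T)^nat) :
  measurable_fun setT f -> (forall x, 0 <= f x)%E ->
  measurable A -> (forall k, measurable (A_ k)) -> A `<=` \bigcup_k A_ k ->
  (\int[mu]_(x in A) f x <= \sum_(0 <= k <oo) \int[mu]_(x in A_ k) f x)%E.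
Proof.
move=> mf f0 mA mA_ AA_.
have mS k : measurable (seqDU A_ k).
  by apply: measurableD => //; exact: bigsetU_measurable.
apply: (@le_trans _ _ (\int[mu]_(x in \bigcup_k seqDU A_ k) f x)%E).
  rewrite -seqDU_bigcup_eq; apply: ge0_subset_integral => //.
    exact: bigcup_measurable.
  exact: measurable_funTS.
rewrite ge0_integral_bigcup//; last exact: measurable_funTS.
apply: lee_nneseries => [k _ _|k _]; first exact: integral_ge0.
by apply: ge0_subset_integral => //; [exact: measurable_funTS|move=> x []].
Qed.

(** * Summation over dyadic shells *)

Section LocalFiniteness.
Context {R : realType} {n : nat}.
Variable s : R.
Hypothesis s01 : 0 < s < 1.
Implicit Types (A B U Omega : set (eucl R n)) (x y : eucl R n).
Local Notation mu := (@leb R n).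

Let emkern x : measurable_fun setT (fun y => (kern s (x, y))%:E).
Proof.
apply/measurable_EFinP; apply: (measurableT_comp (@measurable_kern R n s)).
exact: pair1_measurable.
Qed.

Lemma measurable_int_kern B : measurable B ->
  measurable_fun setT (fun x => \int[mu]_(y in B) (kern s (x, y))%:E)%E.
Proof.
move=> mB; pose f := (fun z => (kern s z)%:E) \_ (setT `*` B).
rewrite (_ : (fun x => _) = fubini_F mu f).
  apply: measurable_fun_fubini_tonelli_F => [|z].
    apply/(measurable_restrictT _ (measurableX measurableT mB)).
    by apply/measurable_EFinP/measurable_funTS; exact: measurable_kern.
  by apply: erestrict_ge0 => ? _; rewrite lee_fin kern_ge0.
apply/funext => x; rewrite integral_mkcond; apply: eq_integral => y _.
by rewrite /f /patch in_setX/= in_setT.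
Qed.

Definition shell x (r : R) : set (eucl R n) :=
  [set y | r / 2 <= enorm ((x : 'rV[R]_n) - y) < r].

Lemma measurable_shell x r : measurable (shell x r).
Proof.
have me : measurable_fun setT (fun y : eucl R n => enorm ((x : 'rV[R]_n) - y)).
  exact: (measurableT_comp (@measurable_enormB R n) (pair1_measurable x)).
rewrite (_ : shell x r = (fun y : eucl R n => enorm ((x : 'rV[R]_n) - y))
    @^-1` `[r / 2, r[); first by rewrite -[X in measurable X]setTI; exact: me.
by apply/seteqP; split => y; rewrite /shell/= in_itv.
Qed.

Lemma ball_enorm x y r : enorm ((x : 'rV[R]_n) - y) < r -> ball (x : 'rV[R]_n) r y.
Proof.
move=> xyr; apply/ball_rowE; first exact: le_lt_trans (enorm_ge0 _) xyr.
by move=> i; apply: le_lt_trans xyr; rewrite (le_trans _ (ler_coord_enorm _ i))// !mxE.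
Qed.

(** On the shell of radius r the kernel is at most (r / 2) ^ (- (n + s)) and the measure at most (2
    r) ^ n; the product of these bounds is c r ^ (- s). *)
Let c : R := 2 ^+ n * 2 `^ (n%:R + s).

Let c_ge0 : 0 <= c. Proof. by rewrite mulr_ge0// powR_ge0. Qed.

Lemma integral_shell x r B : measurable B -> 0 < r ->
  (\int[mu]_(y in B `&` shell x r) (kern s (x, y))%:E <= (c * r `^ (- s))%:E)%E.
Proof.
move=> mB r0; have /andP[s0 _] := s01.
have mBS : measurable (B `&` shell x r).
  by apply: measurableI => //; exact: measurable_shell.
apply: (@le_trans _ _ (\int[mu]_(y in B `&` shell x r)
    ((r / 2) `^ (- (n%:R + s)))%:E)%E).
  apply: ge0_le_integral => //.
  - by move=> y _; rewrite lee_fin kern_ge0.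
  - exact: measurable_funTS.
  - move=> y [_ /andP[ry _]]; rewrite lee_fin /kern powRN.
    have r20 : 0 < r / 2 by rewrite divr_gt0.
    rewrite lef_pV2 ?posrE ?powR_gt0//; last exact: lt_le_trans ry.
    rewrite ge0_ler_powR// ?nnegrE ?addr_ge0// ?ltW//.
    exact: lt_le_trans ry.
rewrite integral_cst//.
apply: (@le_trans _ _ (((r / 2) `^ (- (n%:R + s)))%:E * ((r *+ 2) ^+ n)%:E)%E).
  rewrite lee_wpmul2l ?lee_fin ?powR_ge0//.
  apply: le_trans (leb_ball (x : 'rV[R]_n) r0).
  by apply: le_lebesgue_outer => y [_ /andP[_ /ball_enorm]].
have r0' := ltW r0; have rn0 : r ^+ n != 0 by rewrite expf_neq0// gt_eqF.
have -> : (r / 2) `^ (- (n%:R + s)) = (r ^+ n)^-1 * r `^ (- s) * 2 `^ (n%:R + s).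
  rewrite powRM// opprD powRD ?(gt_eqF r0) ?implybT// (powRN _ n%:R) powR_mulrn//.
  by rewrite -[2^-1]powR_inv1// -powRrM mulN1r opprD !opprK.
rewrite -EFinM lee_fin -[r *+ 2]mulr_natr exprMn /c.
by rewrite le_eqVlt; apply/orP; left; apply/eqP; field.
Qed.

(* [ball] is the ball of the sup norm, so the layer is open and contains the
   points at Euclidean distance < r from the complement. *)
Definition layer Omega (r : R) : set (eucl R n) :=
  \bigcup_(y in ~` Omega) ball (y : 'rV[R]_n) r.

Lemma measurable_layer Omega r : 0 < r -> measurable (layer Omega r).
Proof.
move=> r0; apply: open_measurable_eucl; apply: bigcup_open => y _.
exact: ball_open.
Qed.

(** Shells beyond distance [a] contribute a geometric series of ratio 2 ^ (- s), uniformly in [x],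
    and [U] has finite measure. Shells within distance [a], each seen only from its layer,
    contribute after integration a series of ratio 2 ^ (s - 1). *)
Lemma interaction_lty_layer U Omega (a M : R) :
  measurable U -> measurable Omega -> U `<=` Omega -> (mu U < +oo)%E ->
  0 < a -> 0 <= M ->
  (forall k, mu (U `&` layer Omega (a / 2 ^+ k)) <= (M / 2 ^+ k)%:E)%E ->
  (interaction s U (~` Omega) < +oo)%E.
Proof.
move=> mU mO UO Uoo a0 M0 UM; have /andP[s0 s1] := s01.
have mOC := measurableC mO.
have int0 x B : (0 <= \int[mu]_(y in B) (kern s (x, y))%:E)%E.
  by apply: integral_ge0 => y _; rewrite lee_fin kern_ge0.
pose near_k k : R := c * (a / 2 ^+ k) `^ (- s).
pose far_k k : R := c * (a * 2 ^+ k.+1) `^ (- s).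
have near0 k : 0 <= near_k k by rewrite mulr_ge0// powR_ge0.
have far0 k : 0 <= far_k k by rewrite mulr_ge0// powR_ge0.
pose F : \bar R := (\sum_(0 <= k <oo) (far_k k)%:E)%E.
have farE k : far_k k = c * (a *+ 2) `^ (- s) * (2 `^ (- s)) ^+ k.
  rewrite /far_k exprS mulrA powRM ?exprn_ge0 ?mulr_ge0 ?ltW//.
  by rewrite powR_exprn// mulr_natr mulrA.
(* The growth 2 ^ (s k) of [near_k] is beaten by the decay 2 ^ (- k) of the bound on the layers. *)
have nearE k : near_k k * (M / 2 ^+ k) =
    c * a `^ (- s) * M * (2 `^ (- (1 - s))) ^+ k.
  rewrite /near_k powRM ?invr_ge0 ?exprn_ge0// ?ltW//.
  rewrite -[(2 ^+ k)^-1]exprVn powR_exprn// -[2^-1 in X in X * _]powR_inv1//.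
  rewrite -powRrM mulN1r opprK opprB powRB ?pnatr_eq0 ?implybT// powRr1//.
  by rewrite exprMn; ring.
have Foo : (F < +oo)%E.
  rewrite /F; under eq_eseriesr => k _ do rewrite farE.
  by apply: nneseries_geometric_lty; rewrite ?powR2N_lt1// mulr_ge0// powR_ge0.
have F0 : (0 <= F)%E by apply: nneseries_ge0 => k _ _; rewrite lee_fin.
have mL k : measurable (layer Omega (a / 2 ^+ k)).
  by apply: measurable_layer; rewrite divr_gt0// exprn_gt0.
have mOS x r : measurable (~` Omega `&` shell x r).
  by apply: measurableI => //; exact: measurable_shell.
have inner x : U x -> (\int[mu]_(y in ~` Omega) (kern s (x, y))%:E <=
    \sum_(0 <= k <oo) ((near_k k)%:E * (\1_(layer Omega (a / 2 ^+ k)) x)%:E) + F)%E.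
  move=> Ux; pose B : set (eucl R n) := [set y | enorm ((x : 'rV[R]_n) - y) < a].
  have mB : measurable B.
    rewrite (_ : B = (fun y : eucl R n => enorm ((x : 'rV[R]_n) - y)) @^-1` `]-oo, a[).
      rewrite -[X in measurable X]setTI.
      exact: (measurableT_comp (@measurable_enormB R n) (pair1_measurable x)).
    by apply/seteqP; split => y; rewrite /B/= in_itv.
  have mOB := measurableI _ _ mOC mB; have mODB := measurableD mOC mB.
  rewrite -(setUIDK (~` Omega) B) ge0_integral_setU//; last 3 first.
  - exact: measurable_funTS.
  - by move=> y _; rewrite lee_fin kern_ge0.
  - by apply/disj_setPS => y [[_ ?] []].
  have k0 y : (0 <= (kern s (x, y))%:E)%E by rewrite lee_fin kern_ge0.
  apply: leeD.
    apply: (@le_trans _ _ (\sum_(0 <= k <oo)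
        \int[mu]_(y in ~` Omega `&` shell x (a / 2 ^+ k)) (kern s (x, y))%:E)%E).
      apply: ge0_integral_le_bigcup => // y [Oy By].
      (* The distance is positive because [x] is in [Omega] and [y] is not; hence some dyadic shell
         contains [y]. *)
      have : 0 < enorm ((x : 'rV[R]_n) - y).
        rewrite lt_neqAle enorm_ge0 andbT eq_sym; apply/eqP => /enorm_eq0/eqP.
        by rewrite subr_eq0 => /eqP xy; apply: Oy; rewrite -xy; exact: UO.
      by move=> /dyadic_shell_near/(_ By)[k Hk]; exists k.
    apply: lee_nneseries => [k _ _|k _]; first exact: int0.
    (* If [x] is outside the layer, its shell contains no point of the complement of [Omega]. *)
    rewrite indicE; case: (boolP (x \in _)) => [_|/negP xL].
      by rewrite mule1; apply: integral_shell => //; rewrite divr_gt0// exprn_gt0.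
    rewrite mule0 (_ : _ `&` _ = set0) ?integral_set0// -subset0 => y [Oy].
    move=> /andP[_ /ball_enorm xy]; apply: xL; rewrite inE; exists y => //.
    exact: ball_sym.
  apply: (@le_trans _ _ (\sum_(0 <= k <oo)
      \int[mu]_(y in ~` Omega `&` shell x (a * 2 ^+ k.+1)) (kern s (x, y))%:E)%E).
    apply: ge0_integral_le_bigcup => // y [Oy /negP]; rewrite -leNgt.
    by move=> /(dyadic_shell_far a0)[k Hk]; exists k.
  apply: lee_nneseries => [k _ _|k _]; first exact: int0.
  by apply: integral_shell => //; rewrite mulr_gt0// exprn_gt0.
have m1 k : measurable_fun U
    (fun x => (near_k k)%:E * (\1_(layer Omega (a / 2 ^+ k)) x)%:E)%E.
  apply: emeasurable_funM => //; apply/measurable_EFinP.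
  exact: measurable_indic.
have s0' x : (0 <= \sum_(0 <= k <oo)
    ((near_k k)%:E * (\1_(layer Omega (a / 2 ^+ k)) x)%:E))%E.
  by apply: nneseries_ge0 => k _ _; rewrite mule_ge0// lee_fin.
have ms : measurable_fun U (fun x => \sum_(0 <= k <oo)
    ((near_k k)%:E * (\1_(layer Omega (a / 2 ^+ k)) x)%:E))%E.
  by apply: ge0_emeasurable_sum => // k x _ _; rewrite mule_ge0// lee_fin.
apply: (@le_lt_trans _ _ (\int[mu]_(x in U)
    (\sum_(0 <= k <oo) ((near_k k)%:E * (\1_(layer Omega (a / 2 ^+ k)) x)%:E) + F))%E).
  apply: ge0_le_integral.
  - exact: mU.
  - by move=> x _; exact: int0.
  - by apply: measurable_funTS; exact: measurable_int_kern.
  - by apply: emeasurable_funD => //; exact: measurable_cst.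
  - by move=> x Ux; exact: inner.
rewrite ge0_integralD// integral_cst//= integral_nneseries//; last first.
  by move=> k x _; rewrite mule_ge0// lee_fin.
rewrite lte_add_pinfty ?lte_mul_pinfty ?ge0_fin_numE//.
apply: (@le_lt_trans _ _
    (\sum_(0 <= k <oo) (c * a `^ (- s) * M * (2 `^ (- (1 - s))) ^+ k)%:E)%E).
  apply: lee_nneseries => [k _ _|k _].
    by apply: integral_ge0 => x _; rewrite mule_ge0// lee_fin.
  rewrite ge0_integralZl; [|exact: mU| | |by rewrite lee_fin near0].
  - rewrite integral_indic// setIC -nearE [leRHS]EFinM.
    by apply: lee_wpmul2l; [rewrite lee_fin near0|exact: UM].
  - by apply/measurable_EFinP; exact: measurable_indic.
  - by move=> x _; rewrite lee_fin.
apply: nneseries_geometric_lty; first by rewrite !mulr_ge0// powR_ge0.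
by rewrite powR2N_lt1// subr_gt0.
Qed.

End LocalFiniteness.

(** * Thin layers, and finiteness near each point of the closure *)

Section LipschitzBoundary.
Context {R : realType} {n : nat}.
Implicit Types (x y p : 'rV[R]_n) (Omega : set 'rV[R]_n).
Local Notation mu := (@leb R n).

(* The part of the layer inside the ball lies between the graphs [h = 0] and
   [h = t] with [t = r / 2 ^+ k.+1], so its [2 ^+ k] translates by the multiples
   of [t *: e] are disjoint and contained in a fixed ball. *)
Lemma leb_layer_le Omega p (e : 'rV[R]_n) (h : 'rV[R]_n -> R) (r C : R) k :
  open Omega -> 0 < r -> 1 <= C ->
  (forall i, `|e ord0 i| <= 1) ->
  (forall x t, h (x - t *: e) = h x - t) ->
  (forall x y d, ball x d y -> h x <= h y + C * d) ->
  (forall x, ball p r x -> (Omega x <-> 0 < h x)) ->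
  (mu ((Omega `&` ball p (r / 2)) `&` layer Omega (r / 2 / C / 2 ^+ k))
    <= ((r *+ 2) ^+ n / 2 ^+ k)%:E)%E.
Proof.
move=> oO r0 C1 e1 he hC hO; have C0 : 0 < C by exact: lt_le_trans C1.
have K1 : 1 <= 2 ^+ k :> R by rewrite exprn_ege1// ler1n.
have K0 : 0 < 2 ^+ k :> R by exact: lt_le_trans K1.
(* The width [d] is chosen so that [C * d = t]: over a distance [d] the height [h] varies by at most
   [t]. *)
set d := r / 2 / C / 2 ^+ k; pose t := r / 2 / 2 ^+ k.
have d0 : 0 < d by rewrite !divr_gt0.
have t0 : 0 < t by rewrite !divr_gt0.
have dr : d <= r / 2.
  rewrite /d ler_pdivrMr// ler_pdivrMr// -mulrA.
  apply: ler_peMr; first by rewrite divr_ge0// ltW.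
  by rewrite -[leLHS]mulr1 ler_pM.
have Cd : C * d = t by rewrite /d /t; field; rewrite !gt_eqF.
set S : set (eucl R n) := _ `&` layer _ _.
have mS : measurable S.
  apply: measurableI; last exact: measurable_layer.
  by apply: open_measurable_eucl; apply: openI => //; exact: ball_open.
(* A point [y] of the complement within [d] of [x] has [h y <= 0]: since [d <= r / 2], it is still
   in the ball where [h] describes [Omega]. *)
have Sh x : S x -> 0 < h x <= t.
  move=> [[Ox px] [y Oy yx]]; have xy := ball_sym yx.
  have pr : ball p r x by apply: le_ball px; lra.
  rewrite (hO _ pr).1//=.
  have py : ball p r y.
    by have := ball_triangle px xy; apply: le_ball; lra.
  have hy : h y <= 0 by rewrite leNgt; apply/negP => /(hO _ py).2.
  by have := hC _ _ _ xy; rewrite Cd; lra.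
pose T (j : 'I_(2 ^ k)) : set (eucl R n) := translate ((j%:R * t) *: e) S.
have mT j : measurable (T j) by exact: measurable_translate.
have muT j : mu (T j) = mu S by exact: lebesgue_outer_translate.
(* Each translation raises the heights by a multiple of [t], so the translates occupy disjoint
   ranges of heights. *)
have Th j x : T j x -> j%:R * t < h x <= j.+1%:R * t.
  by move=> /Sh; rewrite he subr_gt0 lerBlDr -natr1 mulrDl mul1r addrC.
have tT : trivIset setT T.
  apply/trivIsetP => i j _ _ ij; rewrite -subset0 => x [/Th + /Th].
  wlog ltij : i j ij / (i < j)%N.
    move=> H; have := ij; rewrite neq_ltn => /orP[|] ltij; first exact: H.
    by move=> ? ?; apply: (H j i) => //; rewrite eq_sym.
  move=> /andP[_ hi] /andP[hj _]; have := lt_le_trans hj hi.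
  by rewrite ltr_pM2r// ltr_nat ltnS leqNgt ltij.
(* Fewer than 2 ^ k steps of size [t], in a direction with coordinates at most 1, move each
   coordinate by at most [r / 2]. *)
have Tp j : T j `<=` ball p r.
  move=> x [[_ +] _] => /ball_rowE px; apply/ball_rowE => // i.
  have {px} := px _ i; rewrite divr_gt0// => /(_ isT); rewrite !mxE.
  have : `|j%:R * t * e ord0 i| <= r / 2.
    rewrite normrM; apply: (@le_trans _ _ (j%:R * t)).
      have jt0 : 0 <= j%:R * t by rewrite mulr_ge0// ltW.
      by rewrite (ger0_norm jt0) ler_piMr.
    rewrite /t mulrCA; apply: ler_piMr; first by rewrite divr_ge0// ltW.
    rewrite ler_pdivrMr// mul1r.
    by rewrite -natrX ler_nat ltnW.
  move: (j%:R * t * _) => u; rewrite ler_norml !ltr_norml => /andP[? ?] /andP[? ?].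
  by apply/andP; split; lra.
have Soo : (mu S \is a fin_num).
  rewrite ge0_fin_numE//; apply: (@le_lt_trans _ _ (mu (ball p (r / 2)))).
    by apply: le_lebesgue_outer => x [[]].
  by apply: le_lt_trans (leb_ball _ _) (ltry _); rewrite divr_gt0.
have : (\sum_(j < 2 ^ k) mu (T j) <= ((r *+ 2) ^+ n)%:E)%E.
  rewrite -measure_bigsetU_ord//; apply: le_trans (leb_ball p r0).
  apply: le_lebesgue_outer; apply: (big_ind (fun A => A `<=` ball p r)) => //.
  by move=> A B AB BB; rewrite subUset.
under eq_bigr do rewrite muT.
rewrite -(fineK Soo) sumEFin sumr_const card_ord !lee_fin => H.
by rewrite ler_pdivlMr// -natrX mulr_natr.
Qed.

(** If the ball of radius [r] lies in [Omega], layers of width at most [r / 2] miss the concentric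
    ball of radius [r / 2], so the layer bound holds with [M = 0]. *)
Lemma interaction_lty_interior (s : R) Omega p : 0 < s < 1 ->
  open Omega -> interior Omega p ->
  exists2 r : R, 0 < r &
    (interaction s (Omega `&` ball p r : set (eucl R n)) (~` Omega) < +oo)%E.
Proof.
move=> s01 oO /nbhs_ballP[r /= r0 rO]; exists (r / 2); first by rewrite divr_gt0.
have r20 : 0 < r / 2 by rewrite divr_gt0.
apply: (@interaction_lty_layer _ _ _ s01 _ _ (r / 2) 0) => //.
- by apply: open_measurable_eucl; apply: openI => //; exact: ball_open.
- exact: open_measurable_eucl.
- apply: (@le_lt_trans _ _ (mu (ball p (r / 2)))).
    by apply: le_lebesgue_outer => x [].
  exact: le_lt_trans (leb_ball _ r20) (ltry _).
move=> k; rewrite (_ : _ `&` _ = set0) ?measure0 ?mul0r// -subset0.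
move=> x [[_ px] [y Oy /ball_sym yx]]; apply: Oy; apply: rO.
have := ball_triangle px yx; apply: le_ball.
have : r / 2 / 2 ^+ k <= r / 2.
  rewrite ler_pdivrMr ?exprn_gt0//; apply: ler_peMr; first exact: ltW.
  by rewrite exprn_ege1// ler1n.
by lra.
Qed.

(** In the chart, [h] is the height above the graph and [e] the upward unit vector, written in the
    original coordinates. They satisfy the hypotheses of [leb_layer_le], which gives the layer
    bound. *)
Lemma interaction_lty_boundary (s : R) Omega p : 0 < s < 1 ->
  open Omega -> lipschitz_boundary Omega -> (closure Omega `\` interior Omega) p ->
  exists2 r : R, 0 < r &
    (interaction s (Omega `&` ball p r : set (eucl R n)) (~` Omega) < +oo)%E.
Proof.
move=> s01 oO LO pO; have [r [Q [i [g [r0 QQ [L gL] hO]]]]] := LO _ pO.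
have QQ' : Q^T *m Q = 1%:M by exact: mulmx1C.
(* The sup-norm ball of radius [r1] lies in the Euclidean ball of radius [r] where the chart is
   valid. *)
pose r1 := r / n.+1%:R; have r10 : 0 < r1 by rewrite divr_gt0.
have r120 : 0 < r1 / 2 by rewrite divr_gt0.
(* The first factor is a Lipschitz constant of [h] for the Euclidean norm, and [n.+1] passes to the
   sup norm. As [L] may be negative, the maximum ensures [1 <= C]. *)
pose C := (1 + Num.max L 0) * n.+1%:R.
have L0 : 0 <= Num.max L 0 by rewrite le_max lexx orbT.
have C1 : 1 <= C by rewrite /C -[leLHS]mulr1 ler_pM ?ler1n// lerDl.
pose e : 'rV[R]_n := delta_mx ord0 i *m Q^T.
pose h x : R := (x *m Q) ord0 i - g (col' i (x *m Q)).
have e1 j : `|e ord0 j| <= 1.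
  apply: le_trans (ler_coord_enorm _ _) _.
  rewrite -(enorm_orthogonal e QQ) -mulmxA QQ' mulmx1 /enorm (bigD1 i)//= big1.
    by rewrite mxE !eqxx expr1n addr0 sqrtr1.
  by move=> l li; rewrite mxE (negbTE li) andbF expr0n.
have he x t : h (x - t *: e) = h x - t.
  rewrite /h mulmxBl -scalemxAl -mulmxA QQ' mulmx1.
  rewrite (_ : col' i (_ - _) = col' i (x *m Q)); last first.
    apply/matrixP => a b; rewrite !mxE (eq_sym _ i) (negbTE (neq_lift _ _)) andbF.
    by rewrite mulr0 subr0.
  by rewrite !mxE !eqxx mulr1 addrAC.
have hC x y d : ball x d y -> h x <= h y + C * d.
  move=> xy; have d0 : 0 < d := xy.1; have {}xy := (ball_rowE x y d0).1 xy.
  have exy : enorm (x - y) <= n.+1%:R * d.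
    apply: (@le_trans _ _ (n%:R * d)).
      by apply: enorm_le; [exact: ltW|move=> j; rewrite !mxE ltW].
    by rewrite ler_pM2r// ler_nat.
  have : `|(x *m Q) ord0 i - (y *m Q) ord0 i| <= enorm (x - y).
    rewrite -(enorm_orthogonal (x - y) QQ) mulmxBl.
    by apply: le_trans (ler_coord_enorm _ i); rewrite !mxE.
  have : `|g (col' i (x *m Q)) - g (col' i (y *m Q))| <= Num.max L 0 * enorm (x - y).
    apply: le_trans (gL _ _) _.
    apply: (@le_trans _ _ (Num.max L 0 * enorm (col' i (x *m Q) - col' i (y *m Q)))).
      by rewrite ler_wpM2r ?enorm_ge0// le_max lexx.
    rewrite ler_wpM2l//.
    rewrite -(enorm_orthogonal (x - y) QQ) mulmxBl -linearB.
    exact: enorm_col'.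
  rewrite /h /C !ler_norml => /andP[gl _] /andP[_ xl].
  have : (1 + Num.max L 0) * enorm (x - y) <= (1 + Num.max L 0) * (n.+1%:R * d).
    by rewrite ler_wpM2l// addr_ge0.
  by rewrite mulrA mulrDl mul1r; lra.
have hO' x : ball p r1 x -> (Omega x <-> 0 < h x).
  move=> /ball_rowE px; rewrite subr_gt0; apply: hO.
  apply: (@le_lt_trans _ _ (n%:R * r1)).
    apply: enorm_le => [|j]; first exact: ltW.
    by rewrite !mxE distrC ltW// px.
  by rewrite /r1 mulrCA gtr_pMr// ltr_pdivrMr// mul1r ltr_nat.
exists (r1 / 2) => //.
apply: (@interaction_lty_layer _ _ _ s01 _ _ (r1 / 2 / C) ((r1 *+ 2) ^+ n)).
- by apply: open_measurable_eucl; apply: openI => //; exact: ball_open.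
- exact: open_measurable_eucl.
- by move=> x [].
- apply: (@le_lt_trans _ _ (mu (ball p (r1 / 2)))).
    by apply: le_lebesgue_outer => x [].
  exact: le_lt_trans (leb_ball _ r120) (ltry _).
- by rewrite divr_gt0// (lt_le_trans _ C1).
- by rewrite exprn_ge0// mulrn_wge0// ltW.
by move=> k; exact: leb_layer_le.
Qed.

End LipschitzBoundary.

(** * From local to global finiteness by compactness *)

Section Compactness.
Context {R : realType} {n : nat}.
Variable s : R.
Hypothesis s01 : 0 < s < 1.
Local Notation mu := (@leb R n).

Lemma interaction_setU_lty (A B C : set (eucl R n)) :
  measurable A -> measurable B -> measurable C ->
  (interaction s A C < +oo)%E -> (interaction s B C < +oo)%E ->
  (interaction s (A `|` B) C < +oo)%E.
Proof.
move=> mA mB mC Aoo Boo.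
have mF : measurable_fun setT (fun x : eucl R n =>
    \int[mu]_(y in C) (kern s (x, y))%:E)%E by exact: measurable_int_kern.
have F0 (x : eucl R n) : (0 <= \int[mu]_(y in C) (kern s (x, y))%:E)%E.
  by apply: integral_ge0 => y _; rewrite lee_fin kern_ge0.
have mBA : measurable (B `\` A) by exact: measurableD.
rewrite (_ : A `|` B = A `|` (B `\` A)); last by rewrite setDE setUIr setUCr setIT.
rewrite /interaction ge0_integral_setU.
- apply: lte_add_pinfty => //; apply: le_lt_trans Boo.
  apply: ge0_subset_integral; [exact: mBA|exact: mB|exact: measurable_funTS|
    by move=> x _; exact: F0|exact: subDsetl].
- exact: mA.
- exact: mBA.
- exact: measurable_funTS.
- by move=> x _; exact: F0.
- by apply/disj_setPS => x [? []].
Qed.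

Lemma bounded_closure (W : set 'rV[R]_n) : bounded_set W -> bounded_set (closure W).
Proof.
move=> [M [Mr WM]]; exists M; split=> // N MN.
have cN : closed [set x : 'rV[R]_n | `|x| <= N].
  apply: (@closed_comp _ _ (fun x : 'rV[R]_n => `|x|) [set u | u <= N]).
    by move=> x _; exact: norm_continuous.
  exact: closed_le.
rewrite closureE => x; apply; split => // y Wy; exact: (WM _ MN y Wy).
Qed.

(** Finitely many of the balls from the interior and boundary cases cover the compact closure of
    [Omega], and finiteness passes to finite unions. *)
Lemma interaction_lty (Omega : set 'rV[R]_n) :
  bounded_set Omega -> open Omega -> lipschitz_boundary Omega ->
  (interaction s (Omega : set (eucl R n)) (~` Omega) < +oo)%E.
Proof.
move=> bO oO LO; have mO : measurable (Omega : set (eucl R n)).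
  exact: open_measurable_eucl.
(* The default radius 0 outside the closure makes the choice function total. *)
have loc p : exists r : R, closure Omega p -> 0 < r /\
    (interaction s (Omega `&` ball p r : set (eucl R n)) (~` Omega) < +oo)%E.
  have [cp|cp] := pselect (closure Omega p); last by exists 0.
  have [ip|ip] := pselect (interior Omega p).
    by have [r r0 ?] := interaction_lty_interior s01 oO ip; exists r.
  by have [r r0 ?] := interaction_lty_boundary s01 oO LO (conj cp ip); exists r.
have [r Hr] := choice loc.
have cO : compact (closure Omega).
  by apply: bounded_closed_compact; [exact: bounded_closure|exact: closed_closure].
move: cO; rewrite compact_cover.
move=> /(_ _ (closure Omega) (fun p => ball p (r p)))[p pO| |D DO OD].
- by apply: ball_open; have [] := Hr p pO.
- by move=> p pO; exists p => //; apply: ballxx; have [] := Hr p pO.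
have := subset_trans (@subset_closure _ Omega) OD.
rewrite /cover bigcup_fset => OD'.
pose W : set 'rV[R]_n := \big[setU/set0]_(p <- finmap.enum_fset D) ball p (r p).
suff [_] : measurable (W : set (eucl R n)) /\
  (interaction s (Omega `&` W : set (eucl R n)) (~` Omega) < +oo)%E by rewrite (setIidl OD').
rewrite /W big_seq; apply: (big_ind (fun A : set 'rV[R]_n =>
  measurable (A : set (eucl R n)) /\
  (interaction s (Omega `&` A : set (eucl R n)) (~` Omega) < +oo)%E)).
- by split; [exact: measurable0|rewrite setI0 /interaction integral_set0].
- move=> A B [mA Aoo] [mB Boo]; split; first exact: measurableU.
  rewrite setIUr; apply: interaction_setU_lty => //.
  + exact: measurableI.
  + exact: measurableI.
  + exact: measurableC.
- move=> p /DO; rewrite inE => /Hr[r0 roo]; split=> //.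
  by apply: open_measurable_eucl; exact: ball_open.
Qed.

End Compactness.

(** * Local convergence *)

Lemma squeeze_cvge0 (R : realType) (u v : (\bar R)^nat) :
  (forall k, 0 <= u k)%E -> (forall k, u k <= v k)%E ->
  v k @[k --> \oo] --> 0%E -> u k @[k --> \oo] --> 0%E.
Proof.
move=> u0 uv; apply: (@squeeze_cvge _ _ _ _ (cst 0%E)); last exact: cvg_cst.
by near=> k; rewrite u0 uv.
Unshelve. all: by end_near. Qed.

Section Limits.
Local Open Scope ereal_scope.
Context {R : realType} {n : nat}.
Implicit Types (A D E F : set (eucl R n)).
Local Notation mu := (@leb R n).
Local Notation mu2 := (mu \x mu).

(** An exhaustion by sets of finite measure, from which the sets [X] of [integral_lsc] are built;
    [M.+1] keeps the radius positive. *)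
Definition rball (M : nat) : set (eucl R n) := ball (0 : 'rV[R]_n)%R M.+1%:R.

Lemma measurable_rball M : measurable (rball M).
Proof. by apply: open_measurable_eucl; exact: ball_open. Qed.

Lemma leb_rball_lty M : mu (rball M) < +oo.
Proof. exact: le_lt_trans (leb_ball _ _) (ltry _). Qed.

Lemma rball_nd : {homo rball : M N / (M <= N)%N >-> M `<=` N}.
Proof. by move=> M N MN x; apply: le_ball; rewrite ler_nat. Qed.

Lemma rballT (x : 'rV[R]_n) : exists M, rball M x.
Proof.
exists (Num.truncn `|x|); rewrite /rball mx_norm_ball /ball_/= sub0r normrN.
exact: truncnS_gt.
Qed.

Definition rball2 (M : nat) : set (eucl R n * eucl R n) := rball M `*` rball M.

Lemma measurable_rball2 M : measurable (rball2 M).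
Proof. by apply: measurableX; exact: measurable_rball. Qed.

Lemma rball2_nd : {homo rball2 : M N / (M <= N)%N >-> M `<=` N}.
Proof. by move=> M N MN x [? ?]; split; exact: (rball_nd MN). Qed.

Lemma rball2T z : exists M, rball2 M z.
Proof.
have [[M Mx] [N Ny]] := (rballT z.1, rballT z.2); exists (maxn M N).
by split; [apply: rball_nd Mx; exact: leq_maxl|apply: rball_nd Ny; exact: leq_maxr].
Qed.

Lemma measurable_setY A D :
  measurable A -> measurable D -> measurable (A `+` D).
Proof. by move=> mA mD; apply: measurableU; exact: measurableD. Qed.

(** The integrand is the indicator of the symmetric difference, and the open ball lies in a compact
    closed one. *)
Lemma cvg_L1loc_leb (E_ : (set (eucl R n))^nat) E :
  (forall k, measurable (E_ k)) -> measurable E ->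
  cvg_L1loc (fun k => \1_(E_ k)) \1_E ->
  forall M, mu ((E_ k `+` E) `&` rball M) @[k --> \oo] --> 0.
Proof.
move=> mE_ mE EE M; pose K : set 'rV[R]_n := [set x | (`|x| <= M.+1%:R)%R].
have cK : closed K.
  apply: (@closed_comp _ _ (fun x : 'rV[R]_n => `|x|%R) [set u | (u <= M.+1%:R)%R]).
    by move=> x _; exact: norm_continuous.
  exact: closed_le.
have bK : bounded_set K.
  exists M.+1%:R; split => [|N MN x /= Kx]; first exact: num_real.
  exact: le_trans Kx (ltW MN).
have mK : measurable (K : set (eucl R n)) by exact: closed_measurable_eucl.
have mD k : measurable (E_ k `+` E) by exact: measurable_setY.
have := EE K (bounded_closed_compact bK cK).
apply: squeeze_cvge0 => k; first exact: measure_ge0.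
rewrite (_ : integral _ _ _ = \int[mu]_(x in K) (\1_(E_ k `+` E) x)%:E).
  rewrite integral_indic//; apply: le_lebesgue_outer => x [Ex].
  rewrite /rball mx_norm_ball /ball_/= sub0r normrN => /ltW xM.
  by split.
apply: eq_integral => x _; congr _%:E; rewrite !indicE.
have [a|a] := pselect (E_ k x); have [b|b] := pselect (E x);
  rewrite ?(mem_set a) ?(memNset a) ?(mem_set b) ?(memNset b) ?subrr ?subr0 ?sub0r
    ?normrN ?normr0 ?normr1.
- by rewrite memNset// => -[[]|[]].
- by rewrite mem_set//; left.
- by rewrite mem_set//; right.
- by rewrite memNset// => -[[]|[]].
Qed.

(** Inside [rball2 M] a pair of [G_ k] has a point in [D_ k], so the measure is at most 2 mu(B)
    mu(D_k in B) with B = [rball M]. *)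
Lemma leb2_cross_cvg0 (D_ : (set (eucl R n))^nat)
    (G_ : (set (eucl R n * eucl R n))^nat) :
  (forall k, measurable (D_ k)) -> (forall k, measurable (G_ k)) ->
  (forall k z, G_ k z -> D_ k z.1 \/ D_ k z.2) ->
  (forall M, mu (D_ k `&` rball M) @[k --> \oo] --> 0) ->
  forall M, mu2 (G_ k `&` rball2 M) @[k --> \oo] --> 0.
Proof.
move=> mD mG GD D0 M; have mB := measurable_rball M.
have mDB k := measurableI _ _ (mD k) mB.
have Bfin : mu (rball M) \is a fin_num by rewrite ge0_fin_numE ?leb_rball_lty.
have BD0 := cvgeZl Bfin (D0 M); rewrite mule0 in BD0.
have := cvgeD (isT : (0 : \bar R) +? 0) BD0 BD0.
rewrite adde0 => /(_ _)/squeeze_cvge0; apply => k; first exact: measure_ge0.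
rewrite -{1}[X in _ <= X + _]muleC -!product_measure1E//.
have mX := (measurableX (mDB k) mB, measurableX mB (mDB k)).
apply: (@le_trans _ _ (mu2 ((D_ k `&` rball M) `*` rball M `|`
                            rball M `*` (D_ k `&` rball M)))); last first.
  by apply: measureU2; [exact: mX.1|exact: mX.2].
apply: le_measure; rewrite ?inE.
- by apply: measurableI => //; exact: measurable_rball2.
- by apply: measurableU; [exact: mX.1|exact: mX.2].
- by move=> z [/GD[?|?] [? ?]]; [left|right].
Qed.

End Limits.

(** * Minimality in the limit *)

Section Minimality.
Local Open Scope ereal_scope.
Context {R : realType} {n : nat}.
Variables (s : R) (Omega : set (eucl R n)).
Implicit Types (A D E F : set (eucl R n)).
Local Notation mu := (@leb R n).
Local Notation mu2 := (mu \x mu).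
Local Notation K := (fun z : eucl R n * eucl R n => (kern s z)%:E).
Hypothesis mO : measurable Omega.

Let K0 z : 0 <= K z. Proof. by rewrite lee_fin kern_ge0. Qed.

Let mK (G : set (eucl R n * eucl R n)) : measurable_fun G K.
Proof. by apply/measurable_EFinP/measurable_funTS; exact: measurable_kern. Qed.

Lemma sperimeter_ge0 E : 0 <= sperimeter s E Omega.
Proof.
have i0 A D : 0 <= interaction s A D.
  apply: integral_ge0 => x _; apply: integral_ge0 => y _.
  by rewrite lee_fin invr_ge0 powR_ge0.
by apply: adde_ge0; [apply: adde_ge0|].
Qed.

(** A pair that crosses [E] but not [E_ k] has a point in the symmetric difference of [E] and
    [E_ k], so [integral_lsc] applies to the crossing sets. *)
Lemma sperimeter_lsc (E_ : (set (eucl R n))^nat) E :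
  (forall k, measurable (E_ k)) -> measurable E ->
  cvg_L1loc (fun k => \1_(E_ k)) \1_E ->
  forall c, c < sperimeter s E Omega ->
  \forall k \near \oo, c < sperimeter s (E_ k) Omega.
Proof.
move=> mE_ mE EE c; rewrite sperimeterE// => cE.
have mC := measurable_crossing mE mO.
have mC_ k := measurable_crossing (mE_ k) mO.
have := integral_lsc (@measurable_kern R n s) (kern_ge0 s) measurable_rball2
  rball2_nd rball2T mC mC_ _ cE.
move=> H; apply: filterS (H _) => [k|]; first by rewrite sperimeterE.
apply: (@leb2_cross_cvg0 _ _ (fun k => E_ k `+` E)).
- by move=> k; exact: measurable_setY.
- by move=> k; exact: measurableD.
- move=> k [x y] [[/= Ex Ey Oxy] nC].
  have [E1|E1] := pselect (E_ k x); last by left; right.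
  have [E2|E2] := pselect (E_ k y); first by right; left.
  by exfalso; apply: nC.
- exact: cvg_L1loc_leb.
Qed.

(** For [A] outside [Omega], these are the pairs whose part in the perimeter may change when a set
    is modified on [A]. *)
Definition cross A : set (eucl R n * eucl R n) := (Omega `*` A) `|` (A `*` Omega).

Let mcross A : measurable A -> measurable (cross A).
Proof. by move=> mA; apply: measurableU; exact: measurableX. Qed.

Lemma integral_cross_lty A : measurable A -> A `<=` ~` Omega ->
  interaction s Omega (~` Omega) < +oo ->
  \int[mu2]_(z in cross A) K z < +oo.
Proof.
move=> mA AO Ooo; have mOC := measurableC mO.
apply: (@le_lt_trans _ _ (\int[mu2]_(z in cross (~` Omega)) K z)).
  apply: ge0_subset_integral; [exact: mcross|exact: mcross|exact: mK|
    by move=> z _; exact: K0|].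
  by move=> z [[? /AO ?]|[/AO ? ?]]; [left|right].
rewrite ge0_integral_setU; [| |exact: measurableX|exact: mK|by move=> z _; exact: K0|].
- rewrite -!interactionE// [X in _ + X]interactionC//.
  exact: lte_add_pinfty.
- exact: measurableX.
- by apply/disj_setPS => z [[? ?] [? ?]].
Qed.

(** The competitor [F_ k] of [E_ k] has perimeter at most that of [F] plus the integral over
    [cross (D k)], which tends to 0 by [integral_cvg0]. *)
Lemma sminimal_le (E_ : (set (eucl R n))^nat) E F :
  interaction s Omega (~` Omega) < +oo ->
  (forall k, measurable (E_ k)) -> measurable E -> measurable F ->
  (forall k, sminimal s (E_ k) Omega) ->
  cvg_L1loc (fun k => \1_(E_ k)) \1_E ->
  mu.-negligible ((F `\` Omega) `+` (E `\` Omega)) ->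
  forall e : R, (0 < e)%R ->
  \forall k \near \oo, sperimeter s (E_ k) Omega <= sperimeter s F Omega + e%:E.
Proof.
move=> Ooo mE_ mE mF Emin EE FE e e0.
(* This is where [F_ k], defined next, differs from [F]. *)
pose D k := (F `+` E_ k) `\` Omega.
pose F_ k := (F `&` Omega) `|` (E_ k `\` Omega).
have mD k : measurable (D k) by apply: measurableD => //; exact: measurable_setY.
have mF_ k : measurable (F_ k).
  by apply: measurableU; [exact: measurableI|exact: measurableD].
(* Outside [Omega], [F] and [E] differ by a null set, so up to a null set [D k] lies in the
   symmetric difference of [E_ k] and [E]. *)
have D0 M : mu (D k `&` rball M) @[k --> \oo] --> 0.
  have := cvg_L1loc_leb mE_ mE EE M; apply: squeeze_cvge0 => k.
    exact: measure_ge0.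
  have [N [mN N0 FN]] := FE.
  have mEB : measurable ((E_ k `+` E) `&` rball M).
    by apply: measurableI; [exact: measurable_setY|exact: measurable_rball].
  apply: (@le_trans _ _ (mu (((E_ k `+` E) `&` rball M) `|` N))).
    apply: le_lebesgue_outer => x [[FEx Ox] Mx].
    have [EEx|EEx] := pselect ((E_ k `+` E) x); first by left.
    right; apply: FN; move: FEx EEx => /=.
    by have [?|?] := pselect (E_ k x); have [?|?] := pselect (E x); tauto.
  apply: (@le_trans _ _ (mu ((E_ k `+` E) `&` rball M) + mu N)).
    exact: measureU2.
  by rewrite N0 adde0.
have G0 := leb2_cross_cvg0 mD (fun k => mcross (mD k)) _ D0.
have {}G0 := G0 ltac:(by move=> k z [[? ?]|[? ?]]; [right|left]).
have mOC := measurableC mO.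
have := integral_cvg0 (@measurable_kern R n s) (kern_ge0 s) measurable_rball2
  rball2_nd rball2T (mcross mOC) (fun k => mcross (mD k)) _
  (integral_cross_lty mOC (@subset_refl _ _) Ooo) G0 e0.
move=> H; apply: filterS (H _) => [k ke|]; last first.
  by move=> k z [[? [? ?]]|[[? ?] ?]]; [left|right].
apply: (@le_trans _ _ (sperimeter s (F_ k) Omega)).
  apply: (Emin k).2 => //.
  rewrite (_ : F_ k `\` Omega = E_ k `\` Omega) ?setYK; first exact: negligible_set0.
  by apply/seteqP; split => x; rewrite /F_/=; tauto.
apply: le_trans (leeD2l _ (ltW ke)).
rewrite !sperimeterE//.
have mC := measurable_crossing mF mO; have mC_ := measurable_crossing (mF_ k) mO.
have mG := mcross (mD k).
(* A pair that crosses [F_ k] but not [F] has a point in [D k], thus outside [Omega], and so its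
   other point in [Omega]. *)
apply: (@le_trans _ _ (\int[mu2]_(z in crossing F Omega `|`
    (cross (D k) `\` crossing F Omega)) K z)).
  apply: ge0_subset_integral; [exact: mC_| |exact: mK|by move=> z _; exact: K0|].
    by apply: measurableU => //; exact: measurableD.
  move=> z; have [?|zF] := pselect (crossing F Omega z); first by left.
  move=> zC; right; split => //; case: z zF zC => x y.
  rewrite /crossing /F_ /cross /D/= => zF [].
  have [?|?] := pselect (F x); have [?|?] := pselect (F y);
  have [?|?] := pselect (E_ k y); have [?|?] := pselect (Omega x);
  have [?|?] := pselect (Omega y); try tauto; by exfalso; apply: zF; split; tauto.
rewrite ge0_integral_setU; [| |exact: measurableD|exact: mK|by move=> z _; exact: K0|].
- apply: leeD2l; apply: ge0_subset_integral; [exact: measurableD|exact: mG|exact: mK|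
    by move=> z _; exact: K0|exact: subDsetl].
- exact: mC.
- by apply/disj_setPS => z [? []].
Qed.

End Minimality.

Lemma cvge_lt_le (R : realType) (u : (\bar R)^nat) (l : R) :
  (forall k, u k \is a fin_num) ->
  (forall c, (c < l%:E)%E -> \forall k \near \oo, (c < u k)%E) ->
  (forall e : R, 0 < e -> \forall k \near \oo, (u k <= l%:E + e%:E)%E) ->
  u k @[k --> \oo] --> l%:E.
Proof.
move=> ufin ul lu; apply/fine_cvgP; split; first exact: nearW.
apply/cvgrPdist_le => e e0; near=> k.
rewrite /= ler_distlC; apply/andP; split.
  have : ((l - e)%:E < u k)%E.
    by near: k; apply: ul; rewrite lte_fin ltrBlDr ltrDl.
  by rewrite -(fineK (ufin k)) lte_fin => /ltW.
have : (u k <= l%:E + e%:E)%E by near: k; exact: lu.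
by rewrite -(fineK (ufin k)) -EFinD lee_fin.
Unshelve. all: by end_near. Qed.

Unset Implicit Arguments.
Set Strict Implicit.

Theorem theorem1p11 (R : realType) (n : nat) (s : R) (Omega : set 'rV[R]_n)
    (E_ : (set (eucl R n))^nat) (E : set (eucl R n)) :
  (0 < n)%N -> 0 < s < 1 ->
  bounded_set Omega -> open Omega -> lipschitz_boundary Omega ->
  (forall k, measurable (E_ k)) -> measurable E ->
  (forall k, sminimal s (E_ k) Omega) ->
  cvg_L1loc (fun k => \1_(E_ k)) \1_E ->
  sminimal s E Omega /\
  sperimeter s (E_ k) Omega @[k --> \oo] --> sperimeter s E Omega.
Proof.
move=> _ s01 bO oO LO mE_ mE Emin EE.
have mO : measurable (Omega : set (eucl R n)) by exact: open_measurable_eucl.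
have Ooo := interaction_lty s01 bO oO LO.
have lsc := sperimeter_lsc mO mE_ mE EE.
have usc F mF FE := @sminimal_le _ _ _ _ mO E_ E F Ooo mE_ mE mF Emin EE FE.
have Ele (F : set (eucl R n)) : measurable F ->
    (@leb R n).-negligible ((F `\` (Omega : set (eucl R n))) `+` (E `\` Omega)) ->
    (sperimeter s E Omega <= sperimeter s F Omega)%E.
  (* If [F] had smaller perimeter, a gap [e] would fit in between; eventually [E_ k] would have
     perimeter above P(F) + e by lower semicontinuity and at most P(F) + e by minimality. *)
  move=> mF FE; rewrite leNgt; apply/negP => FltE.
  have Ffin : sperimeter s F Omega \is a fin_num.
    by rewrite ge0_fin_numE ?sperimeter_ge0// (lt_le_trans FltE)// leey.
  have [e e0 FeE] : exists2 e : R, 0 < e &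
      (sperimeter s F Omega + e%:E < sperimeter s E Omega)%E.
    move: FltE; rewrite -(fineK Ffin).
    (* The perimeter of [E] may still be infinite here; then [e = 1] serves. *)
    case: (sperimeter s E Omega) => [r| |]//; last first.
      by move=> _; exists 1 => //; rewrite ltry.
    rewrite lte_fin => fr; exists ((r - fine (sperimeter s F Omega)) / 2).
      by rewrite divr_gt0// subr_gt0.
    by rewrite -EFinD lte_fin; lra.
  have [k [lk uk]] : exists k,
      (sperimeter s F Omega + e%:E < sperimeter s (E_ k) Omega)%E /\
      (sperimeter s (E_ k) Omega <= sperimeter s F Omega + e%:E)%E.
    apply: (@filter_ex _ \oo); apply: filterI; first exact: lsc.
    exact: usc.
  by have := lt_le_trans lk uk; rewrite ltxx.
have Eoo : (sperimeter s E Omega < +oo)%E.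
  have mEO : measurable (E `\` (Omega : set (eucl R n))) by exact: measurableD.
  (* Removing [Omega] from [E] gives a competitor whose crossing pairs all join [Omega] to its
     complement, so its perimeter is finite. *)
  apply: (@le_lt_trans _ _ (sperimeter s (E `\` Omega) Omega)).
    by apply: Ele => //; rewrite setDDl setUid setYK; exact: negligible_set0.
  have mOC := measurableC mO.
  rewrite sperimeterE//.
  apply: le_lt_trans (integral_cross_lty mO mOC (@subset_refl _ _) Ooo).
  apply: ge0_subset_integral.
  - exact: measurable_crossing.
  - by apply: measurableU; exact: measurableX.
  - by apply/measurable_EFinP/measurable_funTS; exact: measurable_kern.
  - by move=> z _; rewrite lee_fin kern_ge0.
  - by move=> [x y] [/= [_ Ox] _ [//|Oy]]; right.
split; first by split.
have Efin : sperimeter s E Omega \is a fin_num by rewrite ge0_fin_numE ?sperimeter_ge0.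
rewrite -(fineK Efin); apply: cvge_lt_le => [k|c|e e0].
- by rewrite ge0_fin_numE ?sperimeter_ge0//; exact: (Emin k).1.
- by rewrite fineK//; exact: lsc.
(* Taking [F = E] gives the upper bound. *)
rewrite fineK//; apply: usc => //.
by rewrite setYK; exact: negligible_set0.
Qed.
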